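(* Consider the finite horizon discounted expected cost transmission scheduling problem with a single receiver under piecewise-linear convex power-rate curves, as described in the context. For every $n\in\{1,2,\ldots,N\}$ and $s\in\mathcal{S}$, there exists a nonincreasing sequence of critical numbers $\{b_{n,k}(s)\}_{k\in\{0,1,\ldots,K\}}$ such that the optimal number of packets to transmit with $n$ slots remaining, in state $(x,s)$, is given by $$z_n^*(x,s):=\begin{cases}\tilde z_{k-1}(s),&\text{if }b_{n,k}(s)-\tilde z_{k-1}(s)<x\le b_{n,k-1}(s)-\tilde z_{k-1}(s),\ k\in\{0,1,\ldots,K\},\\ b_{n,k}(s)-x,&\text{if }b_{n,k}(s)-\tilde z_k(s)<x\le b_{n,k}(s)-\tilde z_{k-1}(s),\ k\in\{0,1,\ldots,K-1\},\\ b_{n,K}(s)-x,&\text{if }b_{n,K}(s)-\tilde z_{\max}(s)<x\le b_{n,K}(s)-\tilde z_{K-1}(s),\\ \tilde z_{\max}(s),&\text{if }0\le x\le b_{n,K}(s)-\tilde z_{\max}(s),\end{cases}$$ where $b_{n,-1}(s):=\infty$ for all $s\in\mathcal{S}$. The optimal receiver buffer level after transmission is $y_n^*(x,s)=x+z_n^*(x,s)$.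
   Context: Time is discrete and indexed backwards: $n=N,N-1,\ldots,1$ is the number of slots remaining in a horizon of length $N\in\mathbb{N}$. The channel condition process $\{S_n\}$ is a finite-state ergodic homogeneous Markov chain with state space $\mathcal{S}$, unaffected by the scheduling decisions. $P>0$ is the power available per slot and $d>0$ is the number of packets removed from the receiver buffer at the end of each slot. Transmitting $z\ge0$ packets (a real number) under channel condition $s$ consumes power $$c(z,s)=z\,\tilde c_0(s)+\sum_{k=0}^{K-1}\bigl(\tilde c_{k+1}(s)-\tilde c_k(s)\bigr)\max\{z-\tilde z_k(s),0\},$$ where $0<\tilde c_0(s)\le\tilde c_1(s)\le\cdots\le\tilde c_K(s)$ and $0=\tilde z_{-1}(s)<\tilde z_0(s)<\cdots<\tilde z_{K-1}(s)<\tilde z_K(s)=\infty$. Let $\tilde z_{\max}(s)$ be the unique $z$ with $c(z,s)=P$; it is assumed that $\tilde z_{\max}(s)\ge d$ and $\tilde z_{\max}(s)>\tilde z_{K-1}(s)$ for all $s\in\mathcal{S}$. The holding cost function $h:[0,\infty)\to[0,\infty)$ is convex and nondecreasing, with $h(0)=0$ and $\lim_{x\to\infty}h(x)=\infty$. The discount factor is $\alpha\in[0,1]$. At the beginning of slot $n$ the scheduler observes the buffer level $X_n=x\ge0$ and channel condition $S_n=s$ and chooses the number $Z_n=z$ of packets to transmit subject to $\max(0,d-x)\le z\le\tilde z_{\max}(s)$ (no underflow; power constraint). Then $X_{n-1}=X_n+Z_n-d$. The problem is to minimize $\mathbb{E}\bigl[\sum_{t=1}^N\alpha^{N-t}\{c(Z_t,S_t)+h(X_t+Z_t-d)\}\bigr]$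 over all history-dependent randomized and deterministic policies. The dynamic programming equations are $V_0(x,s)=0$ and, for $n=1,\ldots,N$, $$V_n(x,s)=\min_{\max(0,d-x)\le z\le\tilde z_{\max}(s)}\bigl\{c(z,s)+h(x+z-d)+\alpha\,\mathbb{E}[V_{n-1}(x+z-d,S_{n-1})\mid S_n=s]\bigr\},\quad x\ge 0,\ s\in\mathcal{S}.$$ An optimal number of packets to transmit in state $(x,s)$ with $n$ slots remaining is one attaining this minimum. The buffer level after transmission (before playout) is $y=x+z$. *)

(* Defs.v *)
From HB Require Import structures.
From mathcomp Require Import all_boot all_order all_algebra.
From mathcomp Require Import all_classical all_reals all_analysis.
Import Order.TTheory GRing.Theory Num.Theory.
Import numFieldNormedType.Exports.

Set Implicit Arguments.
Unset Strict Implicit.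
Unset Printing Implicit Defensive.

Local Open Scope classical_set_scope.
Local Open Scope ring_scope.

Section MarkovChain.
Context {R : realType} {S : finType}.
Implicit Types p : S -> S -> R.

Definition stochastic p : Prop :=
  (forall s t, 0 <= p s t) /\ (forall s, \sum_(t : S) p s t = 1).

Fixpoint nstep p (m : nat) (s t : S) : R :=
  if m is m'.+1 then \sum_(u : S) p s u * nstep p m' u t else (s == t)%:R.

Definition irreducible p : Prop := forall s t, exists m, 0 < nstep p m s t.

(* The greatest common divisor of the return times to each state is 1. *)
Definition aperiodic p : Prop := forall s (q : nat),
  (forall m, (0 < m)%N -> 0 < nstep p m s s -> (q %| m)%N) -> q = 1%N.

Definition ergodic p : Prop := [/\ stochastic p, irreducible p & aperiodic p].

End MarkovChain.

(* [nknot] is K; [slope s k] (k <= nknot) and [knot s k] (k < nknot) are the slopes c~_k(s) and the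
   breakpoints z~_k(s) of the power-rate curve; other values of k are never
   used. [trans s t] is the probability that the channel condition is t in the
   next slot when it is s in the current one; [drain] is the number d of packets
   removed from the buffer per slot. *)
Record model (R : realType) (S : finType) := Model {
  trans : S -> S -> R;
  nknot : nat;
  slope : S -> nat -> R;
  knot : S -> nat -> R;
  power : R;
  drain : R;
  zmax : S -> R;
  hold : R -> R;
  discount : R }.

Section Scheduling.
Context {R : realType} {S : finType}.
Implicit Types (M : model R S) (s t : S) (x y z : R) (n k : nat).

(* z~_{k-1}(s), with z~_{-1}(s) = 0. *)
Definition knot_pred M s k : R := if k is k'.+1 then knot M s k' else 0.

Definition power_rate M z s : R :=
  z * slope M s 0 +
  \sum_(k < nknot M) (slope M s k.+1 - slope M s k) * Num.max (z - knot M s k) 0.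

(* [hold] is only constrained on [0, +oo[, its domain in the model. The
   equation [zmax_power] determines [zmax], since by [slope0_gt0] and
   [slope_le] the power-rate curve is strictly increasing. *)
Record admissible M : Prop := Admissible {
  trans_ergodic : ergodic (trans M);
  slope0_gt0 : forall s, 0 < slope M s 0;
  slope_le : forall s k, (k < nknot M)%N -> slope M s k <= slope M s k.+1;
  knot_lt : forall s k, (k < nknot M)%N -> knot_pred M s k < knot M s k;
  power_gt0 : 0 < power M;
  drain_gt0 : 0 < drain M;
  zmax_power : forall s, power_rate M (zmax M s) s = power M;
  zmax_drain : forall s, drain M <= zmax M s;
  zmax_knot : forall s, knot_pred M s (nknot M) < zmax M s;
  hold_ge0 : forall x, 0 <= x -> 0 <= hold M x;
  hold_convex : @convex_function R R^o [set x | 0 <= x] (hold M);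
  hold_nondecreasing : {in `[0, +oo[ &, {homo hold M : x y / x <= y}};
  hold0 : hold M 0 = 0;
  hold_cvgy : hold M x @[x --> +oo] --> +oo;
  discount_ge0 : 0 <= discount M;
  discount_le1 : discount M <= 1 }.

Definition feasible M x s : set R :=
  [set z | Num.max 0 (drain M - x) <= z <= zmax M s].

(* The expression minimized in the dynamic programming equation, when [W] is
   the cost-to-go of the next slot. *)
Definition stage_cost M (W : R -> S -> R) x s z : R :=
  power_rate M z s + hold M (x + z - drain M) +
  discount M * \sum_(t : S) trans M s t * W (x + z - drain M) t.

(* V_n. The minimum is written as an infimum, which makes V_n total: where an
   [optimal] transmission exists, the infimum is its cost. *)
Fixpoint value M n : R -> S -> R :=
  if n is n'.+1 then
    fun x s => inf [set stage_cost M (value M n') x s z | z in feasible M x s]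
  else fun=> fun=> 0.

(* Meaningful for n >= 1: [z] attains the minimum defining V_n(x, s). *)
Definition optimal M n x s z : Prop :=
  feasible M x s z /\
  forall z', feasible M x s z' ->
    stage_cost M (value M n.-1) x s z <= stage_cost M (value M n.-1) x s z'.

Definition optimal_level M n x s y : Prop :=
  exists2 z, optimal M n x s z & y = x + z.

(* b_{k-1}, with b_{-1} = +oo. *)
Definition crit_pred (b : nat -> R) k : \bar R :=
  if k is k'.+1 then (b k')%:E else +oo%E.

(* The graph {(x, z) | z = z*(x, s)} of the case definition of z* from the
   critical numbers b_0, ..., b_K; one constructor per case. *)
Inductive crit_rule M s (b : nat -> R) x : R -> Prop :=
| Rule_knot k of (k <= nknot M)%N
    & b k - knot_pred M s k < x
    & (x%:E <= crit_pred b k - (knot_pred M s k)%:E)%E :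
    crit_rule M s b x (knot_pred M s k)
| Rule_level k of (k < nknot M)%N
    & b k - knot M s k < x <= b k - knot_pred M s k :
    crit_rule M s b x (b k - x)
| Rule_last of
    b (nknot M) - zmax M s < x <= b (nknot M) - knot_pred M s (nknot M) :
    crit_rule M s b x (b (nknot M) - x)
| Rule_max of 0 <= x <= b (nknot M) - zmax M s :
    crit_rule M s b x (zmax M s).

End Scheduling.

(* Main.v *)
(* With [G] the cost of the level after transmission (holding cost plus expected
   cost-to-go), let [b_k] be the least minimizer on [d, +oo[ of
   [y |-> c~_k y + G y]. This function is nonincreasing before [b_k] and
   nondecreasing after it, and [b_k] decreases with the slope [c~_k]. The rule
   for [z*] says precisely that, at [z*], the level [x + z*] has reached [b_k]
   for the slope to the right of [z*] and does not exceed [b_k] for the slope to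
   the left. As these slopes are one-sided subgradients of the power-rate curve,
   [z*] is optimal; monotonicity of [b_k] makes it unique. The properties of [G]
   used here (nonnegativity, convexity and no upward jump at the left endpoint)
   pass to the value function, by induction on the number of slots. *)
Require Import Defs.
From mathcomp Require Import all_boot all_order all_algebra.
From mathcomp Require Import all_classical all_reals all_analysis.
From mathcomp Require Import ring lra.
Import Order.TTheory GRing.Theory Num.Theory.
Import numFieldNormedType.Exports.

Local Open Scope classical_set_scope.
Local Open Scope ring_scope.

(** * Convex functions on the nonnegative half-line *)

Section Tame.
Context {R : realType}.
Implicit Types (f g : R -> R) (x y u v : R).

Definition nneg_convex f : Prop := forall x y p q,
  0 <= x -> 0 <= y -> 0 <= p -> 0 <= q -> p + q = 1 ->
  f (p * x + q * y) <= p * f x + q * f y.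

(* The Lipschitz bound from below rules out an upward jump of a convex function
   at 0, where minima could otherwise fail to be attained. *)
Definition tame f : Prop :=
  [/\ forall x, 0 <= x -> 0 <= f x,
      nneg_convex f
    & exists2 L, 0 <= L &
        forall x y, 0 <= x -> x <= y -> f x <= f y + L * (y - x)].

Lemma tame_nondecreasing f :
  (forall x, 0 <= x -> 0 <= f x) -> nneg_convex f ->
  (forall x y, 0 <= x -> x <= y -> f x <= f y) -> tame f.
Proof.
move=> f0 cf mf; split=> //; exists 0 => // x y x0 xy.
by rewrite mul0r addr0 mf.
Qed.

Lemma tame_linear a : 0 <= a -> tame (fun x => a * x).
Proof.
move=> a0; apply: tame_nondecreasing => [x x0|x y p q _ _ _ _ _|x y x0 xy].
- exact: mulr_ge0.
- lra.
- exact: ler_wpM2l.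
Qed.

Lemma tameD f g : tame f -> tame g -> tame (fun x => f x + g x).
Proof.
case=> f0 cf [K K0 Kf] [g0 cg [L L0 Lg]]; split=> [x x0|x y p q x0 y0 p0 q0 pq|].
- by rewrite addr_ge0 ?f0 ?g0.
- have := cf _ _ _ _ x0 y0 p0 q0 pq; have := cg _ _ _ _ x0 y0 p0 q0 pq; lra.
- exists (K + L) => [|x y x0 xy]; first exact: addr_ge0.
  by have := Kf _ _ x0 xy; have := Lg _ _ x0 xy; lra.
Qed.

Lemma tameZ a f : 0 <= a -> tame f -> tame (fun x => a * f x).
Proof.
move=> a0 [f0 cf [K K0 Kf]]; split=> [x x0|x y p q x0 y0 p0 q0 pq|].
- by rewrite mulr_ge0 ?f0.
- have := ler_wpM2l a0 (cf _ _ _ _ x0 y0 p0 q0 pq); lra.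
- exists (a * K) => [|x y x0 xy]; first exact: mulr_ge0.
  by have := ler_wpM2l a0 (Kf _ _ x0 xy); lra.
Qed.

Lemma tame_sum (I : Type) (r : seq I) (P : pred I) (F : I -> R -> R) :
  (forall i, P i -> tame (F i)) -> tame (fun x => \sum_(i <- r | P i) F i x).
Proof.
move=> tF; elim: r => [|i r IHr].
  under [X in tame X]funext do rewrite big_nil.
  by apply: tame_nondecreasing => // x y p q *; rewrite !mulr0 addr0.
under [X in tame X]funext do rewrite big_cons.
by case: (boolP (P i)) => // Pi; apply: tameD => //; exact: tF.
Qed.

(** Clearing the denominator [u - x] lets the inequality cover the degenerate case [u = x]. *)
Lemma nneg_convex_chord f x y u : nneg_convex f -> 0 <= x -> x <= y -> y <= u ->
  (u - x) * f y <= (u - y) * f x + (y - x) * f u.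
Proof.
move=> cf x0 xy yu; have [xu|ux] := ltP x u; last first.
  have -> : y = x by lra.
  have -> : u = x by lra.
  lra.
have d0 : 0 < u - x by lra.
have p0 : 0 <= (u - y) / (u - x) by rewrite divr_ge0//; lra.
have q0 : 0 <= (y - x) / (u - x) by rewrite divr_ge0//; lra.
have pq : (u - y) / (u - x) + (y - x) / (u - x) = 1 by field; lra.
have := cf _ _ _ _ x0 (le_trans x0 (ltW xu)) p0 q0 pq.
have -> : (u - y) / (u - x) * x + (y - x) / (u - x) * u = y by field; lra.
move=> /(ler_wpM2l (ltW d0)) /le_trans; apply.
by rewrite le_eqVlt; apply/orP; left; apply/eqP; field; lra.
Qed.

(** * Least minimizers as thresholds for monotonicity *)

Definition nondecreasing_from f x : Prop :=
  forall u v, x <= u -> u <= v -> f u <= f v.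

(** The chord over [x], [y], [u] gives [f x < f u]; the chord over [x], [u], [v] then gives
    [f u <= f v]. *)
Lemma nneg_convex_rise f x y : nneg_convex f -> 0 <= x -> x < y -> f x < f y ->
  nondecreasing_from f y.
Proof.
move=> cf x0 xy fxy u v yu uv.
have fxu : f x < f u.
  have := nneg_convex_chord _ _ _ _ cf x0 (ltW xy) yu => ch.
  have : (y - x) * f x < (y - x) * f u by nra.
  by rewrite ltr_pM2l; lra.
have ch := nneg_convex_chord _ _ _ _ cf x0 (le_trans (ltW xy) yu) uv.
have : (u - x) * f u <= (u - x) * f v by nra.
by rewrite ler_pM2l; lra.
Qed.

(* The least minimizer of a convex [f] on [0, +oo[, as a threshold for
   monotonicity: adding an increasing function to [f] can only lower it. *)
Definition crit f : R := inf [set x | 0 <= x /\ nondecreasing_from f x].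

Section Crit.
Context {f} (tf : tame f) (fr : exists2 x, 0 <= x & f 0 < f x).

Let D : set R := [set x | 0 <= x /\ nondecreasing_from f x].

Let D0 : D !=set0.
Proof.
have [x x0 fx] := fr; have [_ cf _] := tf.
exists x; split=> //; apply: (@nneg_convex_rise f 0) => //.
by rewrite lt_neqAle x0 andbT; apply: contraTneq fx => <-; rewrite ltxx.
Qed.

Let Dlb : lbound D 0. Proof. by move=> x []. Qed.

Lemma crit_ge0 : 0 <= crit f. Proof. exact: lb_le_inf. Qed.

Lemma crit_le x : 0 <= x -> nondecreasing_from f x -> crit f <= x.
Proof. by move=> x0 fx; apply: ge_inf; [exists 0|]. Qed.

(** Strictly above the infimum this is immediate; at [crit f] itself it follows in the limit from
    the lower Lipschitz bound. *)
Lemma crit_nondecreasing : nondecreasing_from f (crit f).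
Proof.
have [_ _ [L L0 Lf]] := tf; have c0 := crit_ge0.
have above u v : crit f < u -> u <= v -> f u <= f v.
  by move=> /(inf_lt D0)[w [_ fw] wu] uv; apply: fw => //; exact: ltW.
move=> u v; rewrite le_eqVlt => /predU1P[<-{u}|]; last exact: above.
rewrite le_eqVlt => /predU1P[->//|cv].
apply/ler_addgt0Pr => e e0.
(* So close to [crit f] that the Lipschitz error is at most [e]; [L + 1] keeps the divisor
   positive. *)
pose w := Num.min v (crit f + e / (L + 1)).
have e1 : 0 < e / (L + 1) by rewrite divr_gt0//; lra.
have cw : crit f < w by rewrite lt_min cv; lra.
have wv : w <= v by rewrite ge_min lexx.
have wc : w - crit f <= e / (L + 1).
  by have : w <= crit f + e / (L + 1) by [rewrite ge_min lexx orbT]; lra.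
have := Lf _ _ c0 (ltW cw); have := above _ _ cw wv.
have : L * (w - crit f) <= e.
  apply: (@le_trans _ _ ((L + 1) * (w - crit f))).
    by rewrite ler_wpM2r; lra.
  by rewrite mulrC -ler_pdivlMr; lra.
lra.
Qed.

(** A strict rise ending before [crit f] would, by [nneg_convex_rise], yield a threshold below the
    infimum. *)
Lemma crit_nonincreasing x y : 0 <= x -> x <= y -> y <= crit f -> f y <= f x.
Proof.
move=> x0; have [_ cf _] := tf; have c0 := crit_ge0.
have below u v : 0 <= u -> u <= v -> v < crit f -> f v <= f u.
  move=> u0; rewrite le_eqVlt => /predU1P[->//|uv] vc; rewrite leNgt.
  apply/negP => /(nneg_convex_rise _ _ _ cf u0 uv) /crit_le.
  by move/(_ (le_trans u0 (ltW uv))); rewrite leNgt vc.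
move=> xy; rewrite le_eqVlt => /predU1P[yc|]; last exact: below.
move: xy; rewrite yc le_eqVlt => /predU1P[->//|xc].
have fc1 : f (crit f) <= f (crit f + 1) by apply: crit_nondecreasing; lra.
(* Left of [crit f], [f] is nonincreasing and, by the chord up to
   [crit f + 1], does not drop below [f (crit f)] by more than a multiple of
   the distance. *)
apply/ler_addgt0Pr => e e0.
pose C := f (crit f + 1) - f (crit f).
pose w := Num.max x (crit f - e / (C + 1)).
have C0 : 0 <= C by rewrite subr_ge0.
have e1 : 0 < e / (C + 1) by rewrite divr_gt0//; lra.
have wc : w < crit f by rewrite gt_max xc/=; lra.
have xw : x <= w by rewrite le_max lexx.
have cw : crit f - w <= e / (C + 1).
  by have : crit f - e / (C + 1) <= w by [rewrite le_max lexx orbT]; lra.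
have fw := below _ _ x0 xw wc.
have w0 : 0 <= w by exact: le_trans xw.
have ch : (crit f + 1 - w) * f (crit f)
    <= (crit f + 1 - crit f) * f w + (crit f - w) * f (crit f + 1).
  by apply: nneg_convex_chord => //; lra.
have : (crit f - w) * C <= e.
  apply: (@le_trans _ _ ((crit f - w) * (C + 1))).
    by rewrite ler_wpM2l; lra.
  by rewrite -ler_pdivlMr; lra.
rewrite /C; lra.
Qed.

End Crit.
End Tame.

(** * The power-rate curve and its subgradients *)

Section PowerRate.
Context {R : realType} {S : finType} {M : model R S} (hM : admissible M).
Context (s : S).
Implicit Types (z : R) (j k : nat).

Local Notation K := (nknot M).
Local Notation c z := (power_rate M z s).

Lemma slope_gt0 k : (k <= K)%N -> 0 < slope M s k.
Proof.
elim: k => [_|k IHk kK]; first exact: slope0_gt0.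
exact: lt_le_trans (IHk (ltnW kK)) (slope_le hM s kK).
Qed.

Lemma slope_homo j k : (j <= k <= K)%N -> slope M s j <= slope M s k.
Proof.
case/andP => /subnK <-; elim: (k - j)%N => [//|i IHi iK].
exact: le_trans (IHi (ltnW iK)) (slope_le hM s iK).
Qed.

Lemma knot_pred_homo j k : (j <= k <= K)%N -> knot_pred M s j <= knot_pred M s k.
Proof.
case/andP => /subnK <-; elim: (k - j)%N => [//|i IHi iK].
exact: le_trans (IHi (ltnW iK)) (ltW (knot_lt hM s iK)).
Qed.

Lemma knot_pred_ge0 k : (k <= K)%N -> 0 <= knot_pred M s k.
Proof. by move=> kK; apply: (@knot_pred_homo 0). Qed.

Lemma knot_pred_le_zmax k : (k <= K)%N -> knot_pred M s k <= zmax M s.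
Proof.
move=> kK; apply: le_trans (ltW (zmax_knot hM s)).
by apply: knot_pred_homo; rewrite kK /=.
Qed.

Lemma slope_sum k : (k <= K)%N ->
  slope M s k
  = slope M s 0 + \sum_(j < K | (j < k)%N) (slope M s j.+1 - slope M s j).
Proof.
move=> kK.
rewrite -(big_ord_widen _ (fun j => slope M s j.+1 - slope M s j) kK).
by rewrite -(big_mkord xpredT (fun j => slope M s j.+1 - slope M s j)) telescope_sumr// addrC subrK.
Qed.

(** By [slope_sum], slope [k] is slope 0 plus the nonnegative increments of index below [k], so the
    bound can be checked hinge by hinge. *)
Lemma slope_le_power_rate k z z' : (k <= K)%N ->
  (forall j, (j < K)%N -> (if (j < k)%N then z' - z else 0)
     <= Num.max (z' - knot M s j) 0 - Num.max (z - knot M s j) 0) ->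
  slope M s k * (z' - z) <= c z' - c z.
Proof.
move=> kK H; rewrite (slope_sum k kK) /power_rate opprD addrACA -sumrB.
rewrite mulrDl mulrC -mulrBl lerD2l mulr_suml big_mkcond/=.
apply: ler_sum => j _; rewrite -mulrBr.
have d0 : 0 <= slope M s j.+1 - slope M s j by rewrite subr_ge0 slope_le.
by have := ler_wpM2l d0 (H j (ltn_ord j)); case: ifP => //; rewrite mulr0.
Qed.

Lemma knot_le_knot_pred j k : (j < k <= K)%N -> knot M s j <= knot_pred M s k.
Proof. exact: (@knot_pred_homo j.+1). Qed.

Lemma knot_homo j k : (j <= k < K)%N -> knot M s j <= knot M s k.
Proof. by move=> ?; apply: (@knot_pred_homo j.+1 k.+1). Qed.

(** Hinges below [k] are active from [z] on and grow by exactly [z' - z]; the others do not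
    decrease. *)
Lemma power_rate_right k z z' : (k <= K)%N -> knot_pred M s k <= z -> z <= z' ->
  slope M s k * (z' - z) <= c z' - c z.
Proof.
move=> kK kz zz'; apply: slope_le_power_rate => // j jK; case: ltnP => jk.
  have := @knot_le_knot_pred j k; rewrite jk kK => /(_ isT) jz.
  by rewrite !max_l; lra.
by rewrite subr_ge0 ge_max !le_max lexx orbT andbT lerB.
Qed.

(** Hinges from [k] on vanish at [z] and [z']; those below drop by at most [z - z']. The guard
    [k < K] encodes z~_K = +oo. *)
Lemma power_rate_left k z z' : (k <= K)%N ->
  ((k < K)%N -> z <= knot M s k) -> z' <= z ->
  slope M s k * (z' - z) <= c z' - c z.
Proof.
move=> kK zk z'z; apply: slope_le_power_rate => // j jK; case: ltnP => jk.
  rewrite lerBrDr.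
  by have [?|?] := leP 0 (z - knot M s j); rewrite le_max; apply/orP; lra.
have := knot_homo k j; rewrite jk jK => /(_ isT).
by have := zk (leq_ltn_trans jk jK) => *; rewrite !max_r; lra.
Qed.

Lemma power_rate_nondecreasing z z' : 0 <= z -> z <= z' -> c z <= c z'.
Proof.
move=> z0 zz'; have := power_rate_right 0 z z' isT z0 zz'.
suff : 0 <= slope M s 0 * (z' - z) by lra.
by apply: mulr_ge0; [exact/ltW/slope_gt0|rewrite subr_ge0].
Qed.

Lemma power_rate_lipschitz z z' : z <= z' -> c z' <= c z + slope M s K * (z' - z).
Proof.
move=> zz'; have := power_rate_left K z' z (leqnn _) _ zz'.
by rewrite ltnn => /(_ (fun h => match notF h with end)); lra.
Qed.

Lemma power_rate_convex : nneg_convex (fun z => c z).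
Proof.
suff [] : tame (fun z => c z) by [].
apply: tameD.
  under [X in tame X]funext do rewrite mulrC.
  by apply: tame_linear; exact/ltW/slope_gt0.
apply: tame_sum => k _; apply: tameZ; first by rewrite subr_ge0 slope_le.
apply: tame_nondecreasing => [z _|x y p q _ _ p0 q0 pq|x y _ xy].
- by rewrite le_max lexx orbT.
- rewrite ge_max; have xk : x - knot M s k <= Num.max (x - knot M s k) 0.
    by rewrite le_max lexx.
  have yk : y - knot M s k <= Num.max (y - knot M s k) 0 by rewrite le_max lexx.
  have mx : 0 <= Num.max (x - knot M s k) 0 by rewrite le_max lexx orbT.
  have my : 0 <= Num.max (y - knot M s k) 0 by rewrite le_max lexx orbT.
  apply/andP; split; last by rewrite addr_ge0 ?mulr_ge0.
  have := ler_wpM2l p0 xk; have := ler_wpM2l q0 yk.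
  have : knot M s k = p * knot M s k + q * knot M s k by rewrite -mulrDl pq mul1r.
  lra.
- by rewrite ge_max !le_max lexx orbT andbT lerB.
Qed.

End PowerRate.

(** * One slot with a tame cost-to-go: the critical numbers *)

Section Stage.
Context {R : realType} {S : finType} {M : model R S} (hM : admissible M).
Context (W : R -> S -> R) (tW : forall t, tame (W^~ t)) (s : S).
Implicit Types (x z u : R) (j k : nat).

Local Notation K := (nknot M).

(** The cost G of the level y after transmission, in the variable u = y - d. *)
Definition next_cost u : R :=
  hold M u + discount M * \sum_t trans M s t * W u t.

Local Notation g := next_cost.

Lemma stage_costE x z :
  stage_cost M W x s z = power_rate M z s + g (x + z - drain M).
Proof. by rewrite /stage_cost -addrA. Qed.

Lemma hold_tame : tame (hold M).
Proof.
apply: tame_nondecreasing => [x x0|x y p q x0 y0 p0 q0 pq|x y x0 xy].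
- exact: (hold_ge0 hM).
- have p1 : p <= 1 by lra.
  have xD : x \in [set x : R | 0 <= x] by rewrite inE.
  have yD : y \in [set x : R | 0 <= x] by rewrite inE.
  have := hold_convex hM (Itv01 p0 p1) xD yD.
  by rewrite !convRE /= /unstable.onem; have -> : q = 1 - p by lra.
- by apply: (hold_nondecreasing hM) => //; rewrite in_itv/= andbT// (le_trans x0).
Qed.

Lemma next_cost_tame : tame g.
Proof.
apply: tameD; first exact: hold_tame.
apply: tameZ; first exact: discount_ge0.
apply: tame_sum => t _; apply: tameZ => //.
by case: (trans_ergodic hM) => -[].
Qed.

(** With y = u + d this is c~_k y + G y up to the constant c~_k d; hence the shift by [drain M] in
    [crit_level]. *)
Definition level_cost k u : R := slope M s k * u + g u.

Lemma level_cost_tame k : (k <= K)%N -> tame (level_cost k).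
Proof.
move=> kK; apply: tameD; last exact: next_cost_tame.
by apply: tame_linear; apply/ltW/slope_gt0.
Qed.

(** As [g] is nonnegative, the linear term only has to exceed [g 0]; at the witness it equals
    [g 0 + 1]. *)
Lemma level_cost_rise k : (k <= K)%N ->
  exists2 u, 0 <= u & level_cost k 0 < level_cost k u.
Proof.
move=> kK; have [g0 _ _] := next_cost_tame.
have sk := slope_gt0 hM s k kK.
have u0 : 0 <= (g 0 + 1) / slope M s k.
  by apply: divr_ge0; [rewrite addr_ge0// g0|exact: ltW].
exists ((g 0 + 1) / slope M s k) => //.
rewrite /level_cost mulr0 add0r mulrCA divff ?gt_eqF// mulr1.
by have := g0 _ u0; lra.
Qed.

Definition crit_level k : R := drain M + crit (level_cost k).

Local Notation b := crit_level.

Lemma drain_le_crit_level k : (k <= K)%N -> drain M <= b k.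
Proof.
move=> kK; rewrite lerDl; apply: crit_ge0; first exact: level_cost_tame.
exact: level_cost_rise.
Qed.

(** Passing from [j] to [k] adds a nondecreasing linear function, so [level_cost k] is also
    nondecreasing from the threshold of [j]. *)
Lemma crit_level_homo j k : (j <= k <= K)%N -> b k <= b j.
Proof.
move=> /[dup] jkK /andP[jk kK]; have jK := leq_trans jk kK.
have tj := level_cost_tame j jK; have rj := level_cost_rise j jK.
rewrite lerD2l; apply: crit_le.
  exact: crit_ge0.
move=> u v cu uv; have := crit_nondecreasing tj rj u v cu uv.
have := ler_wpM2r (_ : 0 <= v - u) (slope_homo hM s j k jkK).
rewrite subr_ge0 => /(_ uv); rewrite /level_cost; lra.
Qed.

(** * The critical-number rule: existence, feasibility, uniqueness, optimality *)

Lemma crit_rule_exists x : 0 <= x -> exists z, crit_rule M s b x z.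
Proof.
move=> x0; pose P k := (k <= K)%N && (b k - knot_pred M s k < x).
(* The least [k] satisfying [P] selects one of the first two cases of the rule; if there is none,
   the last two remain. *)
have [[k0 Pk0]|noP] := pselect (exists k, P k); last first.
  have xK : x <= b K - knot_pred M s K.
    by rewrite leNgt; apply/negP => ?; apply: noP; exists K; rewrite /P leqnn.
  have [xz|zx] := leP x (b K - zmax M s).
    by exists (zmax M s); apply: Rule_max; rewrite x0.
  by exists (b K - x); apply: Rule_last; rewrite zx.
case: (ex_minnP (ex_intro P k0 Pk0)) => -[|k] /andP[kK kx] kmin.
  by exists 0; apply: (@Rule_knot _ _ M s b x 0) => //=; rewrite leey.
have xk : x <= b k - knot_pred M s k.
  rewrite leNgt; apply/negP => h; have := kmin k.
  by rewrite /P (ltnW kK) h ltnn => /(_ isT).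
have [xk'|kx'] := leP x (b k - knot M s k).
  exists (knot M s k); apply: (@Rule_knot _ _ M s b x k.+1) => //=.
by exists (b k - x); apply: Rule_level => //; rewrite kx'.
Qed.

(** No case underflows, since every [b k] and [zmax M s] are at least [drain M]. *)
Lemma crit_rule_feasible x z : 0 <= x -> crit_rule M s b x z ->
  feasible M x s z.
Proof.
have dz := zmax_drain hM s; have d0 := drain_gt0 hM.
move=> x0; rewrite /feasible/= ge_max; case.
- move=> k kK bx _; have := drain_le_crit_level k kK.
  by have := knot_pred_ge0 hM s k kK; have := knot_pred_le_zmax hM s k kK; lra.
- move=> k kK bx; have := drain_le_crit_level k (ltnW kK).
  have := knot_pred_ge0 hM s k (ltnW kK); have := knot_pred_le_zmax hM s k.+1 kK.
  by rewrite /=; lra.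
- move=> bx; have := drain_le_crit_level K (leqnn _).
  by have := knot_pred_ge0 hM s K (leqnn _); lra.
- by move=> bx; lra.
Qed.

(* z~_k, where z~_K is the power constraint rather than +oo. *)
Definition knot_end k : R := if (k < K)%N then knot M s k else zmax M s.

(* Increasing [z] beyond such a point costs at least [slope s k] per packet, and
   the level is already above the minimizer [b_k] for that slope. *)
Definition enough x z k : Prop :=
  [/\ (k <= K)%N, knot_pred M s k <= z & b k <= x + z].

(** Mirror image of [enough]: decreasing [z] saves at most [slope M s k] per packet, and the level
    is not above the minimizer. *)
Definition no_excess x z k : Prop :=
  [/\ (k <= K)%N, z <= knot_end k & x + z <= b k].

Lemma crit_rule_enough x z : crit_rule M s b x z ->
  z = zmax M s \/ exists k, enough x z k.
Proof.
case.
- by move=> k kK bx _; right; exists k; split=> //; lra.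
- by move=> k kK bx; right; exists k; split; [exact: ltnW|lra|lra].
- by move=> bx; right; exists K; split=> //; lra.
- by move=> _; left.
Qed.

Lemma crit_rule_no_excess x z : crit_rule M s b x z ->
  z = 0 \/ exists k, no_excess x z k.
Proof.
case.
(* At index 0 the transmission is 0; at [k.+1] it is the knot z~_k, whose left slope has index
   [k]. *)
- move=> [|k] kK _ /=; first by left.
  rewrite -EFinB lee_fin => bx; right; exists k; rewrite /no_excess /knot_end kK.
  by split; [exact: ltnW| |lra].
- move=> k kK bx; right; exists k; rewrite /no_excess /knot_end kK.
  by split; [exact: ltnW|lra|lra].
- move=> bx; right; exists K; rewrite /no_excess /knot_end ltnn.
  by split=> //; lra.
- move=> bx; right; exists K; rewrite /no_excess /knot_end ltnn.
  by split=> //; lra.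
Qed.

(** If z < z', then b_j <= x + z < x + z' <= b_k forces k < j, whence z' <= z~_k <= z~_{j-1} <= z, a
    contradiction. *)
Lemma crit_rule_le x z z' : 0 <= x ->
  crit_rule M s b x z -> crit_rule M s b x z' -> z' <= z.
Proof.
move=> x0 rz rz'; rewrite leNgt; apply/negP => zz'.
have := crit_rule_feasible x z x0 rz; have := crit_rule_feasible x z' x0 rz'.
rewrite /feasible/= !ge_max => z'm zm.
have [?|[j [jK jz bj]]] := crit_rule_enough x z rz; first lra.
have [?|[k [kK kz bk]]] := crit_rule_no_excess x z' rz'; first lra.
have kj : (k < j)%N.
  rewrite ltnNge; apply/negP => jk.
  by have := crit_level_homo j k; rewrite jk kK => /(_ isT); lra.
have := knot_le_knot_pred hM s k j; rewrite kj jK => /(_ isT).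
by move: kz; rewrite /knot_end (leq_trans kj jK); lra.
Qed.

(** The subgradient inequality bounds the change of cost below by the change of [level_cost k],
    which is nonnegative when moving away from its minimizer. *)
Lemma crit_rule_optimal x z z' : 0 <= x -> crit_rule M s b x z ->
  feasible M x s z' -> stage_cost M W x s z <= stage_cost M W x s z'.
Proof.
move=> x0 rz; have := crit_rule_feasible x z x0 rz.
rewrite /feasible/= !ge_max !stage_costE => fz fz'.
have [zz'|z'z] := leP z z'.
  have [zm|[k [kK kz bk]]] := crit_rule_enough x z rz.
    by have -> : z' = z by lra.
  have := power_rate_right hM s k z z' kK kz zz'.
  have : level_cost k (x + z - drain M) <= level_cost k (x + z' - drain M).
    apply: crit_nondecreasing; [exact: level_cost_tame|exact: level_cost_rise| |];
    by move: bk; rewrite /crit_level; lra.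
  rewrite /level_cost; lra.
have [z0|[k [kK kz bk]]] := crit_rule_no_excess x z rz; first lra.
have := power_rate_left hM s k z z' kK.
rewrite {1}/knot_end in kz; move=> /(_ _ (ltW z'z)).
have kz' : (k < K)%N -> z <= knot M s k by move=> h; rewrite h in kz.
move=> /(_ kz').
have : level_cost k (x + z - drain M) <= level_cost k (x + z' - drain M).
  apply: crit_nonincreasing; [exact: level_cost_tame|exact: level_cost_rise| | |];
  by move: bk; rewrite /crit_level; lra.
rewrite /level_cost; lra.
Qed.

(** * The optimal stage cost is again tame *)

Lemma stage_cost_ge0 x z : 0 <= x -> feasible M x s z ->
  0 <= stage_cost M W x s z.
Proof.
move=> x0; rewrite /feasible/= ge_max stage_costE => fz.
have [g0 _ _] := next_cost_tame; have y0 : 0 <= x + z - drain M by lra.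
have z0 : 0 <= z by lra.
have := power_rate_nondecreasing hM s 0 z (lexx _) z0.
have -> : power_rate M 0 s = 0.
  rewrite /power_rate mul0r add0r big1// => k _.
  rewrite max_r ?mulr0// sub0r oppr_le0.
  exact: (knot_pred_ge0 hM s k.+1).
by have := g0 _ y0; lra.
Qed.

(** For [W := value M n] this is [value M n.+1] at [s] by conversion. *)
Definition best_cost x : R := inf [set stage_cost M W x s z | z in feasible M x s].

Lemma best_cost_le x z : 0 <= x -> feasible M x s z ->
  best_cost x <= stage_cost M W x s z.
Proof.
move=> x0 fz; apply: ge_inf; last by exists z.
by exists 0 => _ [z' fz' <-]; exact: stage_cost_ge0.
Qed.

Lemma best_cost_attained x : 0 <= x ->
  exists2 z, feasible M x s z & best_cost x = stage_cost M W x s z.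
Proof.
move=> x0; have [z rz] := crit_rule_exists x x0.
have fz := crit_rule_feasible x z x0 rz; exists z => //.
apply/eqP; rewrite eq_le best_cost_le//=; apply: lb_le_inf.
  by exists (stage_cost M W x s z), z.
by move=> _ [z' fz' <-]; exact: crit_rule_optimal.
Qed.

(** For convexity, mixing the minimizers at [x] and [y] is feasible for the mixed buffer, and the
    stage cost is jointly convex. *)
Lemma best_cost_tame : tame best_cost.
Proof.
have [g0 cg [L L0 Lg]] := next_cost_tame.
have d0 := drain_gt0 hM; have dz := zmax_drain hM s.
split.
- move=> x x0; have [z fz ->] := best_cost_attained x x0.
  exact: stage_cost_ge0.
- move=> x y p q x0 y0 p0 q0 pq.
  have [z fz ->] := best_cost_attained x x0.
  have [w fw ->] := best_cost_attained y y0.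
  move: fz fw; rewrite /feasible/= !ge_max => fz fw.
  have d1 : drain M = p * drain M + q * drain M by rewrite -mulrDl pq mul1r.
  have z1 : zmax M s = p * zmax M s + q * zmax M s by rewrite -mulrDl pq mul1r.
  apply: (@le_trans _ _ (stage_cost M W (p * x + q * y) s (p * z + q * w))).
    apply: best_cost_le; first by rewrite addr_ge0 ?mulr_ge0.
    by rewrite /feasible/= ge_max; nra.
  rewrite !stage_costE.
  have := power_rate_convex hM s z w p q; have := cg (x + z - drain M) (y + w - drain M) p q.
  have -> : p * (x + z - drain M) + q * (y + w - drain M)
      = p * x + q * y + (p * z + q * w) - drain M by rewrite [in RHS]d1; ring.
  move=> /(_ _ _ p0 q0 pq) h1 /(_ _ _ p0 q0 pq) h2.
  have h1' := h1 ltac:(lra) ltac:(lra); have h2' := h2 ltac:(lra) ltac:(lra).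
  lra.
(* The smaller buffer raises the transmission and lowers the level by at most [y - x] each, costing
   at most [slope M s K] and [L] per packet. *)
- exists (slope M s K + L) => [|x y x0 xy].
    by rewrite addr_ge0// ltW// slope_gt0.
  have y0 := le_trans x0 xy.
  have [z fz ->] := best_cost_attained y y0.
  move: fz; rewrite /feasible/= ge_max => fz.
  (* From the smaller buffer, reach the same level unless the power constraint
     is active. *)
  pose w := Num.min (z + (y - x)) (zmax M s).
  have w1 : w <= z + (y - x) by rewrite ge_min lexx.
  have w2 : w <= zmax M s by rewrite ge_min lexx orbT.
  have zw : z <= w by rewrite le_min; lra.
  have dw : drain M - x <= w by rewrite le_min; lra.
  apply: (@le_trans _ _ (stage_cost M W x s w)).
    by apply: best_cost_le => //; rewrite /feasible/= ge_max; lra.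
  rewrite !stage_costE.
  have sK := ltW (slope_gt0 hM s K (leqnn _)).
  have h1 := power_rate_lipschitz hM s z w zw.
  have h2 : slope M s K * (w - z) <= slope M s K * (y - x) by rewrite ler_wpM2l; lra.
  have h3 : g (x + w - drain M) <= g (y + z - drain M)
      + L * (y + z - drain M - (x + w - drain M)) by apply: Lg; lra.
  have h4 : L * (y + z - drain M - (x + w - drain M)) <= L * (y - x).
    by rewrite ler_wpM2l; lra.
  lra.
Qed.

End Stage.

(** * Induction on the number of slots and the structure theorem *)

Lemma value_tame (R : realType) (S : finType) (M : model R S) :
  admissible M -> forall n s, tame (value M n ^~ s).
Proof.
move=> hM; elim=> [|n IHn] s; last exact: best_cost_tame.
by apply: tame_nondecreasing => // x y p q *; rewrite !mulr0 addr0.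
Qed.

Theorem theorem3 (R : realType) (S : finType) (M : model R S)
    (hM : admissible M) (N : nat) (n : nat) (hn : (1 <= n <= N)%N) (s : S) :
  exists b : nat -> R,
    (forall k : nat, (k < nknot M)%N -> b k.+1 <= b k) /\
    exists zstar : R -> R,
      forall x : R, 0 <= x ->
        [/\ forall z : R, crit_rule M s b x z <-> z = zstar x,
            optimal M n x s (zstar x)
          & optimal_level M n x s (x + zstar x)].
Proof.
have tV := value_tame _ _ _ hM n.-1.
pose b := @crit_level _ _ M (value M n.-1) s; exists b; split.
  by move=> k kK; apply: crit_level_homo => //; rewrite leqnSn.
(* The guard under the existential lets [choice] range over all reals; the value 0 at negative [x]
   is arbitrary. *)
have rule x : exists z, 0 <= x -> crit_rule M s b x z.
  have [x0|x0] := leP 0 x; last by exists 0.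
  by have [z rz] := @crit_rule_exists _ _ M (value M n.-1) s x x0; exists z.
have [zstar rstar] := choice rule.
exists zstar => x x0; have rx := rstar x x0.
have ox : optimal M n x s (zstar x).
  split; first exact: crit_rule_feasible rx.
  by move=> z' fz'; apply: crit_rule_optimal rx _.
split=> // [z|]; last by exists (zstar x).
split=> [rz|->//]; apply/eqP; rewrite eq_le.
by apply/andP; split; apply: (crit_rule_le hM _ tV s x).
Qed.
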